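(* Let $\mathbb{F}_q$ be a finite field, $\mathcal{V}$ a vector space over $\mathbb{F}_q$, and $k,t$ integers with $0\le t\le k$ and $k\ge 2t$. Let $n\ge 3$ and let $\mathcal{C}=\{\pi_1,\ldots,\pi_n\}$ be a $(k,k-t)$-SCID in $\mathcal{V}$. Define $S:=\langle \pi_1,\ldots,\pi_n\rangle$ and $I:=\langle \pi_i\cap\pi_j \mid 1\le i<j\le n\rangle$. Then \[\dim S+\dim I\le 2k+2(n-2)t-(n-3).\]
   Context: A $(k,k-t)$-SCID is a set of (distinct) $k$-dimensional subspaces of $\mathcal{V}$, containing at least two elements, such that any two distinct members intersect in a subspace of dimension exactly $k-t$. $\langle\cdot\rangle$ denotes the span. *)

(* Defs.v *)
From mathcomp Require Export all_boot all_order all_algebra.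
From mathcomp Require Export boolp classical_sets.

Set Implicit Arguments.
Unset Strict Implicit.
Unset Printing Implicit Defensive.

Import GRing.Theory.
Local Open Scope classical_set_scope.
Local Open Scope ring_scope.

(* The ambient space is an arbitrary left module over a field, so that it may be
   infinite-dimensional; [vectType] would force it to be finite-dimensional. *)
Section Subspaces.
Variables (F : fieldType) (V : lmodType F).

Definition is_subspace (U : set V) : Prop := GRing.submod_closed [in U].

Definition lspan (A : set V) : set V := smallest is_subspace A.

Definition lin_indep (d : nat) (b : 'I_d -> V) : Prop :=
  forall c : 'I_d -> F, \sum_(i < d) c i *: b i = 0 -> forall i, c i = 0.

(* A relation rather than a [nat]-valued function: it holds for no [d] when [U]
   is not a subspace or is infinite-dimensional. *)
Definition has_dim (U : set V) (d : nat) : Prop :=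
  exists b : 'I_d -> V, lin_indep b /\ lspan (range b) = U.

(* (k, m)-SCID; [m] is the dimension of the pairwise intersections. *)
Definition is_SCID (k m : nat) (C : set (set V)) : Prop :=
  [/\ exists U W, [/\ C U, C W & U <> W],
      forall U, C U -> has_dim U k
    & forall U W, C U -> C W -> U <> W -> has_dim (U `&` W) m].

End Subspaces.

(* Main.v *)
From HB Require Import structures.
Require Import Defs.
From mathcomp Require Import zify.

(** Let [S] and [I] be the join of a family of [k]-spaces and the span of its
    pairwise meets. Adding a new member [P] adds to [I] only vectors of
    [P :&: S], so by Grassmann's formula [dim S + dim I] grows by at most
    [k - dim (P :&: I)]. A pair of members has [dim S + dim I = 2 k], and since
    triple intersections have dimension at least [k - 2 t], a third member adds
    at most [2 t]. It remains to gain one unit for each further member [P]. If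
    some triple [A], [B], [C] meets in dimension exactly [k - 2 t], we start with
    it: then [C = A :&: C + B :&: C] lies in [I], so [P :&: I] contains
    [P :&: C], of dimension [k - t > k - 2 t]. Otherwise [P :&: I] contains
    [A :&: B :&: P], of dimension greater than [k - 2 t].

    All this takes place in the span of finitely many finite-dimensional
    subspaces, which is identified with a space of row vectors. *)

Set Implicit Arguments.
Unset Strict Implicit.
Unset Printing Implicit Defensive.

(** * Joins and pairwise meets of a finite family of subspaces *)

Section SubspaceFamilies.
Variables (F : fieldType) (vT : vectType F) (T : finType) (p : T -> {vspace vT}).

Definition family_join (A : {set T}) : {vspace vT} := (\sum_(i in A) p i)%VS.

Definition family_meets (A : {set T}) : {vspace vT} :=
  (\sum_(i in A) \sum_(j in A | j != i) (p i :&: p j))%VS.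

Lemma family_join_sup (A : {set T}) i : i \in A -> (p i <= family_join A)%VS.
Proof. by move=> Ai; apply: (sumv_sup i). Qed.

Lemma family_meets_sup (A : {set T}) i j :
  i \in A -> j \in A -> j != i -> (p i :&: p j <= family_meets A)%VS.
Proof.
move=> Ai Aj ji; apply: (sumv_sup i) => //.
by apply: (sumv_sup j) => //; apply/andP.
Qed.

Lemma family_meets_sub_join (A : {set T}) : (family_meets A <= family_join A)%VS.
Proof.
apply/subv_sumP => i Ai; apply/subv_sumP => j _.
by rewrite (subv_trans (capvSl _ _)) // family_join_sup.
Qed.

Lemma family_joinU1 x (A : {set T}) :
  x \notin A -> family_join (x |: A) = (family_join A + p x)%VS.
Proof. by move=> xA; rewrite /family_join big_setU1 //= addvC. Qed.

(** The only new meets are those of [p x] with a [p j], [j] in [A], and [p j] lies in the join of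
    [A]. *)
Lemma family_meetsU1_sub x (A : {set T}) :
  (family_meets (x |: A) <= family_meets A + (p x :&: family_join A))%VS.
Proof.
have meet_x j : j \in A -> (p x :&: p j <= p x :&: family_join A)%VS.
  by move=> Aj; rewrite capvS // family_join_sup.
apply/subv_sumP => i; rewrite in_setU1 => /orP ix.
apply/subv_sumP => j; rewrite in_setU1 => /andP[/orP jx ji].
case: ix ji => [/eqP-> | Ai]; case: jx => [/eqP-> | Aj] ji.
- by rewrite eqxx in ji.
- exact: subv_trans (meet_x j Aj) (addvSr _ _).
- by rewrite capvC; apply: subv_trans (meet_x i Ai) (addvSr _ _).
- by apply: subv_trans (addvSl _ _); apply: family_meets_sup.
Qed.

(** Grassmann twice: the join grows by [dim (p x)] minus the dimension of [p x :&: family_join A].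
    The meets grow by at most that dimension, less that of its trace on [family_meets A]. The common
    term cancels, and [W] lies in the trace. *)
Lemma dim_join_meetsU1 x (A : {set T}) (W : {vspace vT}) :
  x \notin A -> (W <= family_meets A)%VS -> (W <= p x)%VS ->
  (\dim (family_join (x |: A)) + \dim (family_meets (x |: A)) + \dim W
   <= \dim (family_join A) + \dim (family_meets A) + \dim (p x))%N.
Proof.
move=> xA WI Wx; rewrite family_joinU1 //.
have /dimvS le_meets := family_meetsU1_sub x A.
have /dimvS le_W : (W <= family_meets A :&: (p x :&: family_join A))%VS.
  by rewrite !subv_cap WI Wx (subv_trans WI) ?family_meets_sub_join.
have := dimv_sum_cap (family_join A) (p x).
have := dimv_sum_cap (family_meets A) (p x :&: family_join A).
rewrite [(family_join A :&: p x)%VS]capvC; lia.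
Qed.

Lemma dim_join_meets2 a b : a != b ->
  (\dim (family_join [set a; b]) + \dim (family_meets [set a; b])
   <= \dim (p a) + \dim (p b))%N.
Proof.
move=> ab; rewrite -(dimv_sum_cap (p a)) leq_add //.
  by rewrite /family_join big_setU1 ?inE //= big_set1.
apply/dimvS/subv_sumP => i iA; apply/subv_sumP => j /andP[jA ji].
move: iA jA ji; rewrite !inE => /orP[] /eqP-> /orP[] /eqP->; rewrite ?eqxx //.
by rewrite capvC.
Qed.

(** * Families of [k]-spaces with pairwise meets of dimension [k - t] *)

Variables (k t : nat).
Hypothesis tk : (2 * t <= k)%N.
Hypothesis t_gt0 : (0 < t)%N.
Hypothesis dim_p : forall i, \dim (p i) = k.
Hypothesis dim_pp : forall i j, i != j -> \dim (p i :&: p j) = (k - t)%N.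

(** Grassmann for the traces of [p i] and [p j] on [p l], whose intersection is the triple meet. *)
Lemma dim_cap3_cap_sum i j l : i != l -> j != l ->
  (\dim (p i :&: p j :&: p l) + \dim ((p i :&: p l) + (p j :&: p l))
   = 2 * (k - t))%N.
Proof.
move=> il jl; have := dimv_sum_cap (p i :&: p l) (p j :&: p l).
rewrite !dim_pp //.
have -> : (p i :&: p l :&: (p j :&: p l) = p i :&: p j :&: p l)%VS.
  by rewrite capvA -[(p i :&: p l :&: p j)%VS]capvA (capvC (p l)) !capvA -capvA capvv.
lia.
Qed.

(** The sum of the two traces has dimension at most [k], which leaves at least [2 * (k - t) - k] for
    the triple meet. *)
Lemma dim_cap3_ge i j l : i != l -> j != l ->
  (k - 2 * t <= \dim (p i :&: p j :&: p l))%N.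
Proof.
move=> il jl; have := dim_cap3_cap_sum il jl.
have : ((p i :&: p l) + (p j :&: p l) <= p l)%VS by rewrite subv_add !capvSr.
move/dimvS; rewrite dim_p; lia.
Qed.

(** Equality case of the previous bound: the two traces on [p l] have a sum of dimension [k], hence
    fill [p l]. *)
Lemma cap3_min_sub_meets (A : {set T}) i j l :
  i \in A -> j \in A -> l \in A -> i != l -> j != l ->
  \dim (p i :&: p j :&: p l) = (k - 2 * t)%N -> (p l <= family_meets A)%VS.
Proof.
move=> Ai Aj Al il jl dmin; have := dim_cap3_cap_sum il jl.
have sub_l : ((p i :&: p l) + (p j :&: p l) <= p l)%VS by rewrite subv_add !capvSr.
move=> dimE; have /eqP <- : ((p i :&: p l) + (p j :&: p l) == p l)%VS.
  rewrite eqEdim sub_l dim_p; lia.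
by rewrite subv_add !family_meets_sup // eq_sym.
Qed.

(** Induction on the list [s] of members added to the base triple: the triple has bound
    [2 * k + 2 * t], and each new member contributes at most [2 * t - 1]. Terms are moved across the
    inequality to avoid truncated subtraction. *)
Lemma dim_join_meets_triple a b c (s : seq T) :
  a != b -> a != c -> b != c ->
  \dim (p a :&: p b :&: p c) = (k - 2 * t)%N \/
    (forall x, x != a -> x != b -> (k - 2 * t < \dim (p a :&: p b :&: p x))%N) ->
  let A := [set x in s] :|: [set c; a; b] in
  (\dim (family_join A) + \dim (family_meets A) + #|A| + 4 * t
   <= 2 * k + 2 * #|A| * t + 3)%N.
Proof.
move=> ab ac bc abc_case /=; elim: s => [|x s IH].
  have c_new : c \notin [set a; b] by rewrite !inE negb_or eq_sym ac eq_sym bc.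
  have capS : (p a :&: p b :&: p c <= family_meets [set a; b])%VS.
    rewrite (subv_trans (capvSl _ _)) // family_meets_sup ?inE ?eqxx ?orbT //.
    by rewrite eq_sym.
  have -> : [set x in [::]] :|: [set c; a; b] = c |: [set a; b].
    by apply/setP => y; rewrite !inE -orbA.
  have := dim_join_meetsU1 c_new capS (capvSr _ _).
  have := dim_join_meets2 ab; have := dim_cap3_ge ac bc.
  rewrite cardsU1 c_new cards2 ab !dim_p; lia.
rewrite set_cons -finset.setUA; set A := (_ :|: _) in IH *.
(* The list may repeat members or meet the base triple; the family is then unchanged. *)
have [xA | xA] := boolP (x \in A).
  by rewrite (finset.setUidPr _) // finset.sub1set.
have [Aa Ab Ac] : [/\ a \in A, b \in A & c \in A].
  by rewrite !inE !eqxx !orbT.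
have [xa xb xc] : [/\ x != a, x != b & x != c].
  by split; apply: contraNneq xA => ->.
have [W [WI Wx dimW]] : exists W : {vspace vT},
    [/\ (W <= family_meets A)%VS, (W <= p x)%VS & (k - 2 * t < \dim W)%N].
  case: abc_case => [dmin | dbig].
    (* Here [p c] lies in the meets, and [k - 2 * t < k - t] because [0 < t]. *)
    exists (p c :&: p x)%VS; rewrite capvSr dim_pp 1?eq_sym //.
    rewrite (subv_trans (capvSl _ _)) ?(cap3_min_sub_meets _ _ _ _ _ dmin) //.
    split=> //; lia.
  exists (p a :&: p b :&: p x)%VS; rewrite capvSr dbig //.
  by rewrite (subv_trans (capvSl _ _)) // family_meets_sup // eq_sym.
have := dim_join_meetsU1 xA WI Wx; rewrite cardsU1 xA dim_p; nia.
Qed.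

Lemma dim_join_meets_bound : (2 < #|T|)%N ->
  (\dim (family_join [set: T]) + \dim (family_meets [set: T]) + #|T| + 4 * t
   <= 2 * k + 2 * #|T| * t + 3)%N.
Proof.
move=> T_gt2.
have full a b c : [set x in enum T] :|: [set c; a; b] = [set: T].
  by apply/setP => x; rewrite !inE mem_enum.
suff [a [b [c [ab ac bc abc_case]]]] : exists a b c, [/\ a != b, a != c, b != c &
    \dim (p a :&: p b :&: p c) = (k - 2 * t)%N \/
    (forall x, x != a -> x != b -> (k - 2 * t < \dim (p a :&: p b :&: p x))%N)].
  have /= := dim_join_meets_triple (enum T) ab ac bc abc_case.
  by rewrite full cardsT.
have [/existsP[a /existsP[b /existsP[c /and4P[ab ac bc /eqP dmin]]]] | no_min] :=
  boolP [exists a, exists b, exists c, [&& a != b, a != c, b != c &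
    \dim (p a :&: p b :&: p c) == (k - 2 * t)%N]].
  by exists a, b, c; split=> //; left.
(* With no triple meet of minimal dimension, any three distinct members can serve as the base. *)
have /card_gt2P[a [b [c [_ [ab bc ca]]]]] : (2 < #|[set: T]|)%N by rewrite cardsT.
exists a, b, c; split; rewrite // 1?eq_sym //; right=> x xa xb.
rewrite ltn_neqAle dim_cap3_ge 1?eq_sym // andbT eq_sym.
apply: contraNneq no_min => dmin.
apply/existsP; exists a; apply/existsP; exists b; apply/existsP; exists x.
by rewrite ab [a == x]eq_sym xa [b == x]eq_sym xb dmin eqxx.
Qed.

End SubspaceFamilies.

Import GRing.Theory.
Local Open Scope classical_set_scope.
Local Open Scope ring_scope.

(** * Subspaces as sets, spans and coordinates in an arbitrary module *)

Section SetSubspaces.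
Variables (F : fieldType) (V : lmodType F).
Implicit Types (U A : set V).

Lemma is_subspaceP U :
  is_subspace U <-> U 0 /\ forall a u v, U u -> U v -> U (a *: u + v).
Proof.
split=> [[U0 Ulin] | [U0 Ulin]]; split; rewrite ?inE // in U0 *.
  by move=> a u v Uu Uv; have := Ulin a u v; rewrite !inE; apply.
by move=> a u v; rewrite !inE; apply: Ulin.
Qed.

Lemma subspace_lincomb U (I : Type) (r : seq I) (P : pred I) (c : I -> F) (f : I -> V) :
  is_subspace U -> (forall i, P i -> U (f i)) -> U (\sum_(i <- r | P i) c i *: f i).
Proof.
move=> /is_subspaceP[U0 Ulin] Uf; elim/big_rec: _ => // i v Pi Uv.
by apply: Ulin => //; apply: Uf.
Qed.

Lemma subspace_sum U (I : Type) (r : seq I) (P : pred I) (f : I -> V) :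
  is_subspace U -> (forall i, P i -> U (f i)) -> U (\sum_(i <- r | P i) f i).
Proof.
move=> Usub Uf; under eq_bigr do rewrite -[f _]scale1r.
exact: subspace_lincomb.
Qed.

Lemma is_subspace_lspan A : is_subspace (lspan A).
Proof.
apply/is_subspaceP; split=> [U [/is_subspaceP[]] // | a u v Au Av U [Usub AU]].
have /is_subspaceP[_ Ulin] := Usub.
by apply: Ulin; [apply: Au | apply: Av].
Qed.

Lemma lspan_eq A U : is_subspace U -> A `<=` U -> U `<=` lspan A -> lspan A = U.
Proof. by move=> Usub AU US; apply/seteqP; split=> //; apply: smallest_sub. Qed.

Lemma is_subspace_image (W : lmodType F) (f : {linear W -> V}) (B : {pred W}) :
  GRing.submod_closed B -> is_subspace (f @` [set` B]).
Proof.
move=> [B0 Blin]; apply/is_subspaceP; split; first by exists 0; rewrite ?linear0.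
move=> a _ _ [x Bx <-] [y By <-]; exists (a *: x + y); last by rewrite linearP.
exact: Blin.
Qed.

(** Coordinate rows give access to the finite-dimensional theory: for independent [b] this map
    identifies ['rV[F]_d] with the span of [b]. *)
Definition lincomb (d : nat) (b : 'I_d -> V) (x : 'rV[F]_d) : V :=
  \sum_i x 0 i *: b i.

Fact lincomb_is_linear d (b : 'I_d -> V) : linear (lincomb b).
Proof.
move=> a x y; rewrite /lincomb scaler_sumr -big_split /=.
by apply: eq_bigr => i _; rewrite !mxE scalerDl scalerA.
Qed.

HB.instance Definition _ d (b : 'I_d -> V) :=
  GRing.isLinear.Build F 'rV[F]_d V *:%R (lincomb b) (lincomb_is_linear b).

Lemma lspan_range d (b : 'I_d -> V) : lspan (range b) = range (lincomb b).
Proof.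
apply: lspan_eq.
- have := @is_subspace_image _ (lincomb b) predT.
  rewrite (_ : [set` predT] = setT); first by apply; split.
  by apply/seteqP; split.
- move=> _ [i _ <-]; exists (delta_mx 0 i) => //.
  rewrite /lincomb (bigD1 i) //= big1 ?addr0 => [|j ji].
    by rewrite mxE !eqxx scale1r.
  by rewrite mxE (negbTE ji) andbF scale0r.
- move=> _ [x _ <-]; apply: (subspace_lincomb _ _ (is_subspace_lspan _)).
  by move=> i _; apply: sub_gen_smallest; exists i.
Qed.

Lemma lincomb_inj d (b : 'I_d -> V) : lin_indep b -> injective (lincomb b).
Proof.
move=> b_indep x y xy; apply/rowP => i; apply/eqP; rewrite -subr_eq0; apply/eqP.
have : lincomb b (x - y) = 0 by rewrite linearB /= xy subrr.
by move/(b_indep (fun i => (x - y) 0 i)) => /(_ i); rewrite !mxE.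
Qed.

(* A spanning family of least size is independent. *)
Lemma exists_indep_cover d (b : 'I_d -> V) A :
  A `<=` range (lincomb b) ->
  exists m (e : 'I_m -> V), lin_indep e /\ A `<=` range (lincomb e).
Proof.
move=> Ab; pose P m := `[< exists e : 'I_m -> V, A `<=` range (lincomb e) >].
have exP : exists m, P m by exists d; apply/asboolP; exists b.
case: (ex_minnP exP) => m /asboolP[e Ae] m_min; exists m, e; split=> // c c0 i.
apply/eqP; apply: contraT => ci.
case: m i e Ae m_min c c0 ci => [[]//|m] i e Ae m_min c c0 ci.
suff /m_min : P m by rewrite ltnn.
apply/asboolP; exists (e \o lift i) => v /Ae[x _ <-].
(* As [c i] is nonzero, the relation [c0] expresses [e i] through the other vectors; [y] holds the
   coefficients of [v] after this substitution. *)
pose y : 'rV[F]_m := \row_j (x 0 (lift i j) - x 0 i / c i * c (lift i j)).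
exists y => //; rewrite /lincomb (bigD1_ord i) //=.
have -> : e i = - \sum_j (c (lift i j) / c i) *: e (lift i j).
  apply: (@scalerI _ _ (c i)) => //; apply/eqP.
  rewrite scalerN -addr_eq0 scaler_sumr.
  apply/eqP; rewrite -[RHS]c0 (bigD1_ord i) //=; congr (_ + _).
  by apply: eq_bigr => j _; rewrite scalerA mulrC divfK.
rewrite scalerN scaler_sumr addrC -sumrB; apply: eq_bigr => j _.
rewrite mxE scalerA -scalerBl; congr ((_ - _) *: _).
by rewrite mulrAC mulrA.
Qed.

(** The bases of all [pi i], concatenated by enumerating the pairs of indices, form a finite cover,
    which is then shrunk to an independent one. *)
Lemma has_dim_indep_cover n (pi : 'I_n -> set V) k :
  (forall i, has_dim (pi i) k) ->
  exists m (e : 'I_m -> V), lin_indep e /\ forall i, pi i `<=` range (lincomb e).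
Proof.
move=> pik; have [b b_pi] := choice pik.
pose e (l : 'I_#|{: 'I_n * 'I_k}|) := b (enum_val l).1 (enum_val l).2.
have cover : \bigcup_i pi i `<=` range (lincomb e).
  move=> v [i _]; have [_ <-] := b_pi i; rewrite -lspan_range.
  apply: smallest_sub; first exact: is_subspace_lspan.
  move=> _ [j _ <-]; apply: sub_gen_smallest.
  by exists (enum_rank (i, j)) => //; rewrite /e enum_rankK.
have [m [e' [e'_indep e'_cover]]] := exists_indep_cover cover.
exists m, e'; split=> // i; apply: subset_trans e'_cover.
exact: bigcup_sup.
Qed.

End SetSubspaces.

(** * Transfer of subspaces and dimensions along an injective linear map *)

Section Transfer.
Variables (F : fieldType) (V : lmodType F) (W : vectType F).
Variables (f : {linear W -> V}) (f_inj : injective f).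

Lemma is_subspace_imagev (A : {vspace W}) : is_subspace (f @` [set` A]).
Proof. exact: is_subspace_image (memv_submod_closed A). Qed.

Lemma has_dim_image (A : {vspace W}) : has_dim (f @` [set` A]) (\dim A).
Proof.
exists (fun i => f (vbasis A)`_i); split.
  move=> c /eqP; under eq_bigr do rewrite -linearZ.
  rewrite -linear_sum -(linear0 f) => /eqP /f_inj.
  by move/freeP: (basis_free (vbasisP A)); apply.
apply: lspan_eq.
- exact: is_subspace_imagev.
- move=> _ [i _ <-]; exists (vbasis A)`_i => //=.
  by rewrite vbasis_mem // mem_nth // size_tuple.
- move=> _ [x /= Ax <-]; rewrite (coord_vbasis Ax) linear_sum.
  under eq_bigr do rewrite linearZ /=.
  apply: (subspace_lincomb _ _ (is_subspace_lspan _)).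
  by move=> i _; apply: sub_gen_smallest; exists i.
Qed.

(** A basis of [U] is lifted through [f]; the lifts are free because [f] sends a relation among them
    to one among the basis vectors. *)
Lemma has_dim_pullback (U : set V) d : has_dim U d -> U `<=` range f ->
  exists A : {vspace W}, U = f @` [set` A] /\ \dim A = d.
Proof.
move=> [b [b_indep spanb]] Uf.
have b_im i : exists x, f x = b i.
  have /Uf[x _ <-] : U (b i) by rewrite -spanb; apply: sub_gen_smallest; exists i.
  by exists x.
have [a fa] := choice b_im.
pose X := [tuple a i | i < d].
have XE (i : 'I_d) : X`_i = a i by rewrite -tnth_nth tnth_mktuple.
have X_free : free X.
  apply/freeP => c c0; apply: b_indep; rewrite -[RHS](linear0 f) -c0 linear_sum.
  by apply: eq_bigr => i _; rewrite linearZ /= XE fa.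
exists <<X>>%VS; split; last by rewrite (eqnP X_free) size_tuple.
rewrite -spanb; apply: lspan_eq.
- exact: is_subspace_imagev.
- move=> _ [i _ <-]; exists (a i); last exact: fa.
  by rewrite /= memv_span // -XE mem_nth // size_tuple.
- move=> _ [x Xx <-]; rewrite (coord_span (Xx : x \in <<X>>%VS)) linear_sum.
  under eq_bigr do rewrite linearZ XE fa /=.
  apply: (subspace_lincomb _ _ (is_subspace_lspan _)).
  by move=> i _; apply: sub_gen_smallest; exists i.
Qed.

(** This gives uniqueness of the dimension: the pullback of dimension [d] has the same image as [A],
    so injectivity makes them equal. *)
Lemma has_dim_dimv (A : {vspace W}) d : has_dim (f @` [set` A]) d -> \dim A = d.
Proof.
move=> /has_dim_pullback[|B [AB <-]]; first by move=> _ [x _ <-]; exists x.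
congr (\dim _); apply/vspaceP => x; apply/idP/idP => xin.
  have : (f @` [set` B]) (f x) by rewrite -AB; exists x.
  by case=> y /= yB /f_inj <-.
have : (f @` [set` A]) (f x) by rewrite AB; exists x.
by case=> y /= yB /f_inj <-.
Qed.

Lemma image_capv (A B : {vspace W}) :
  f @` [set` (A :&: B)%VS] = (f @` [set` A]) `&` (f @` [set` B]).
Proof.
apply/seteqP; split=> [_ [x /= /memv_capP[xA xB] <-]
                      | _ [[x /= xA <-] [y /= yB /f_inj yx]]].
  by split; exists x.
by exists x => //=; apply/memv_capP; rewrite -{2}yx.
Qed.

Lemma image_sumv_sub (U : set V) (I : finType) (P : pred I) (A : I -> {vspace W}) :
  is_subspace U -> (forall i, P i -> f @` [set` A i] `<=` U) ->
  f @` [set` (\sum_(i | P i) A i)%VS] `<=` U.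
Proof.
move=> Usub AU _ [x /= /memv_sumP[y yA ->] <-]; rewrite linear_sum.
apply: subspace_sum => // i Pi; apply: (AU i Pi).
by exists (y i) => //=; apply: yA.
Qed.

End Transfer.

(** * The bound for set-based subspaces, by passage to row vectors *)

Theorem theorem4 (F : finFieldType) (V : lmodType F) (k t n : nat)
    (pi : 'I_n -> set V) :
  (0 <= t <= k)%N -> (2 * t <= k)%N -> (3 <= n)%N ->
  injective pi ->
  is_SCID k (k - t)%N (range pi) ->
  exists dS dI : nat,
    [/\ has_dim (lspan (\bigcup_(i in setT) pi i)) dS,
        has_dim (lspan [set v | exists i j : 'I_n,
                                 (i < j)%N /\ (pi i `&` pi j) v]) dI
      & dS%:Z + dI%:Z
          <= 2 * k%:Z + 2 * (n%:Z - 2) * t%:Z - (n%:Z - 3)].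
Proof.
move=> _ tk n3 pi_inj [_ pi_dim piI_dim].
have pik i : has_dim (pi i) k by apply: pi_dim; exists i.
have [m [e [/lincomb_inj e_inj e_cover]]] := has_dim_indep_cover pik.
have pullback i := has_dim_pullback (pik i) (e_cover i).
have [p pP] := choice pullback.
have pE i : pi i = lincomb e @` [set` p i] by case: (pP i).
have dim_p i : \dim (p i) = k by case: (pP i).
have dim_pp i j : i != j -> \dim (p i :&: p j) = (k - t)%N.
  move=> ij; apply: (has_dim_dimv e_inj); rewrite image_capv // -!pE.
  by apply: piI_dim; [exists i | exists j | move/pi_inj => /eqP; apply/negP].
(* If [t] were zero, two members would meet in dimension [k], so both would equal their
   intersection, against injectivity of [pi]. *)
have t_gt0 : (0 < t)%N.
  rewrite lt0n; apply/eqP => t0.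
  pose i : 'I_n := Ordinal (ltn_trans (isT : 0 < 2)%N n3).
  pose j : 'I_n := Ordinal (ltn_trans (isT : 1 < 2)%N n3).
  have dim_ij : \dim (p i :&: p j) = k by rewrite dim_pp // t0 subn0.
  have /eqP capi : (p i :&: p j == p i)%VS by rewrite eqEdim capvSl dim_p dim_ij /=.
  have /eqP capj : (p i :&: p j == p j)%VS by rewrite eqEdim capvSr dim_p dim_ij /=.
  by have /pi_inj : pi i = pi j by rewrite !pE -capi capj.
have bound := dim_join_meets_bound tk t_gt0 dim_p dim_pp.
rewrite card_ord in bound.
exists (\dim (family_join p [set: 'I_n])), (\dim (family_meets p [set: 'I_n])); split.
- rewrite (lspan_eq (is_subspace_imagev (lincomb e) (family_join p [set: 'I_n]))).
  + exact: has_dim_image.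
  + move=> v [i _]; rewrite pE => -[x /= xp <-]; exists x => //=.
    exact: subvP (family_join_sup p (finset.in_setT i)) _ xp.
  + apply: image_sumv_sub => [|i _]; first exact: is_subspace_lspan.
    by rewrite -pE => v piv; apply: sub_gen_smallest; exists i.
- rewrite (lspan_eq (is_subspace_imagev (lincomb e) (family_meets p [set: 'I_n]))).
  + exact: has_dim_image.
  + move=> v [i [j [ij]]]; rewrite !pE -image_capv // => -[x /= xp <-].
    exists x => //=; apply: subvP xp.
    apply: family_meets_sup; rewrite ?finset.in_setT //.
    by rewrite neq_ltn ij orbT.
  + apply: image_sumv_sub => [|i _]; first exact: is_subspace_lspan.
    apply: image_sumv_sub => [|j /andP[_ ji]]; first exact: is_subspace_lspan.
    rewrite image_capv // -!pE => v [vi vj]; apply: sub_gen_smallest => /=.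
    (* [family_meets] runs over ordered pairs, the statement over [i < j]; the smaller index is put
       first. *)
    by move: ji; rewrite neq_ltn => /orP[ij | ij]; [exists j, i | exists i, j].
- move: (bound n3).
  (* Over the integers, moving [n] and [4 * t] back to the right turns [bound] into the stated
     inequality. *)
  set dS := (\dim (family_join _ _)); set dI := (\dim (family_meets _ _)).
  lia.
Qed.
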